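(* In the Serial Parallel Decision Problem with any number $p$ of processors, the scheduler $\mathsf{ins}$ is a $2$-competitive instantly-committing scheduler.
   Context: Serial Parallel Decision Problem (SPDP): there are $p$ identical processors. An instance is a task arrival process $\mathcal{T}=(\tau_1,\dots,\tau_n)$ with $\tau_i=(\sigma_i,\pi_i,t_i)$, where $\sigma_i$ is the work of the serial implementation, $\pi_i$ the work of the parallel implementation, and $t_i$ the arrival time, $t_1\le\dots\le t_n$. A scheduler chooses for each task whether to serialize it (its $\sigma_i$ work may be processed by at most one processor at any time) or parallelize it (its $\pi_i$ work may be processed by any number of processors at once); each processor works on at most one task per time step, no work is done before arrival, and the completion time is when all work is done. An instantly-committing scheduler chooses serial/parallel for each task irrevocably at its arrival. A scheduler is $c$-competitive if on every instance its completion time is at most $c$ times the minimum completion time of an offline valid schedule. For $t\ge0$, $\mathcal{T}^t$ is the truncation to tasks with $t_i\le t$, and $C^t$ is the minimum completion time of an offline valid schedule for $\mathcal{T}^t$. The scheduler $\mathsf{ins}$: when $\tau_i$ arrives, parallelize $\tau_i$ if $\sigma_i+t_i>2C^{t_i}$, otherwise serialize it. At each time step, if $x$ serial jobs are present, allocate a processor to each of the $\min(p,x)$ serial jobs with the most remaining work and allocate any remaining processors to an arbitrary parallel job (if present).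
   Formalization: It is assumed that the serial work is at most the parallel work of each task (σ_i ≤ π_i); without this the claim fails, e.g. for p=1 and tasks (10,10,0), (20,1,0), (20,1,0), where the optimum is 12 but ins serializes everything and needs 50 steps. *)

(* Defs.v *)
From mathcomp Require Import all_boot all_order all_algebra.
Set Implicit Arguments.
Unset Strict Implicit.
Unset Printing Implicit Defensive.

(* Time is divided into unit steps, step s being the interval [s, s + 1), and
   the unit of work is what one processor does in one step; hence works,
   arrival times and completion times are natural numbers. *)

Record task := Task {
  serial_work : nat;
  parallel_work : nat;
  arrival : nat
}.

Definition instance := seq task.

Definition no_task := Task 0 0 0.
Definition nth_task (T : instance) (i : nat) : task := nth no_task T i.

(* The second conjunct is the standing assumption that parallelizing a task
   never reduces its total work. It cannot be dropped: with one processor and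
   the tasks (10,10,0), (20,1,0), (20,1,0) the optimum is 12, so the scheduler
   ins serializes all three tasks and needs 50 > 2 * 12 steps. *)
Definition task_arrival_process (T : instance) : Prop :=
  sorted leq [seq arrival x | x <- T] /\
  all (fun x => serial_work x <= parallel_work x) T.

(* For a task arrival process this is a prefix of T, so a task keeps its
   index. *)
Definition truncate (T : instance) (t : nat) : instance :=
  [seq x <- T | arrival x <= t].

Definition is_minimum (P : nat -> Prop) (m : nat) : Prop :=
  P m /\ forall k, P k -> m <= k.

(* Tasks are referred to by their index in the instance. *)
Record schedule (p : nat) := Schedule {
  parallelized : nat -> bool;
  assigned : nat -> 'I_p -> option nat  (* step -> processor -> task, if any *)
}.

Section Schedules.
Variable p : nat.
Implicit Types (T : instance) (S : schedule p) (s i : nat).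

Definition processors_on S s i : nat := #|[set q | assigned S s q == Some i]|.

Definition total_work T S i : nat :=
  if parallelized S i then parallel_work (nth_task T i)
  else serial_work (nth_task T i).

Definition remaining T S s i : nat :=
  total_work T S i - \sum_(u < s) processors_on S u i.

Definition valid_schedule T S : Prop :=
  (forall s q i, assigned S s q = Some i ->
     i < size T /\ arrival (nth_task T i) <= s) /\
  (forall s i, ~~ parallelized S i -> processors_on S s i <= 1).

Definition completed_by T S c : Prop :=
  forall i, i < size T ->
    arrival (nth_task T i) <= c /\ remaining T S c i = 0.

Definition completion_time T S c : Prop := is_minimum (completed_by T S) c.

Definition optimal_time T c : Prop :=
  is_minimum (fun k => exists S, valid_schedule T S /\ completed_by T S k) c.

Definition scheduler := instance -> schedule p.
Implicit Types A : scheduler.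

(* What happens in step s (which task each processor works on, and in which
   mode) is determined by the tasks that have arrived by time s. *)
Definition online A : Prop :=
  forall T T' s,
    task_arrival_process T -> task_arrival_process T' ->
    truncate T s = truncate T' s ->
    forall q, assigned (A T) s q = assigned (A T') s q /\
      forall i, assigned (A T) s q = Some i ->
        parallelized (A T) i = parallelized (A T') i.

Definition commits_at_arrival A : Prop :=
  forall T T' i,
    task_arrival_process T -> task_arrival_process T' -> i < size T ->
    let t := arrival (nth_task T i) in
    truncate T t = truncate T' t ->
    parallelized (A T) i = parallelized (A T') i.

Definition instantly_committing_scheduler A : Prop :=
  [/\ forall T, task_arrival_process T ->
        valid_schedule T (A T) /\ exists c, completed_by T (A T) c,
      online A
    & commits_at_arrival A].

Definition competitive (R : numDomainType) (c : R) A : Prop :=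
  forall T, task_arrival_process T ->
    exists m k, [/\ completion_time T (A T) m, optimal_time T k
                  & (m%:R <= c * k%:R :> R)%R].

Definition ins_decision T S : Prop :=
  forall i, i < size T ->
    let x := nth_task T i in
    exists c, optimal_time (truncate T (arrival x)) c /\
      parallelized S i = (2 * c < serial_work x + arrival x).

Definition present T S s i : bool :=
  [&& i < size T, arrival (nth_task T i) <= s & 0 < remaining T S s i].

Definition serial_jobs T S s : {set 'I_(size T)} :=
  [set i : 'I_(size T) | present T S s i && ~~ parallelized S i].

Definition running_serial_jobs T S s : {set 'I_(size T)} :=
  [set i in serial_jobs T S s | 0 < processors_on S s i].

(* The last two clauses of ins_step say that the processors left over by the
   serial jobs go to one parallel job, and go on to another one only when there
   is not enough work left in the former to occupy all of them for this step:
   a processor stays idle only if every parallel job present gets as many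
   processors as it has units of work left, and at most one parallel job is
   worked on without being finished. *)
Definition ins_step T S s : Prop :=
  [/\ forall q i, assigned S s q = Some i -> present T S s i,
      forall i, processors_on S s i <=
        (if parallelized S i then remaining T S s i else 1),
      #|running_serial_jobs T S s| = minn p #|serial_jobs T S s| /\
      (forall i j : 'I_(size T), i \in running_serial_jobs T S s ->
         j \in serial_jobs T S s -> j \notin running_serial_jobs T S s ->
         remaining T S s j <= remaining T S s i),
      forall q, assigned S s q = None ->
        forall i, present T S s i -> parallelized S i ->
          processors_on S s i = remaining T S s i
    & forall i j : nat, i != j -> parallelized S i -> parallelized S j ->
        0 < processors_on S s i -> 0 < processors_on S s j ->
        processors_on S s i = remaining T S s i \/
        processors_on S s j = remaining T S s j].

(* ins leaves some choices open (ties, and which parallel job to run), so it is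
   a property of schedulers; online only says that these choices may not
   depend on the future. *)
Definition is_ins A : Prop :=
  online A /\
  forall T, task_arrival_process T ->
    ins_decision T (A T) /\ forall s, ins_step T (A T) s.

End Schedules.

(* Main.v *)
(* Write C t for the optimal completion time of the tasks that have arrived by
   time t. The invariant is that at every time t the work that ins has left is
   at most p (2 C t - t), and at most 2 C t - t for each serialized task; at
   t = 2 C it says that ins is done. A step without arrivals preserves it because
   running the longest serial jobs first loses at most one unit per job, and
   either all processors are busy or all parallel jobs finish.

   When tasks arrive at t, compare with an optimal schedule for these tasks, of
   total work at most p C t <= p (2 C t - t). It can spend less than ins only on
   tasks that ins parallelized and it serializes. Let u be the last arrival of
   such a task: the task fits serially before C t, hence 2 C u < C t. If some
   processor of ins idled in a step of [u, t), then the tasks arrived by u that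
   are still unfinished are serialized by ins, so that ins has no more work left
   than the optimum has in total. Otherwise ins processed p (t - u) units since
   time u, when at most p (2 C u - u) were left, and at most p (C t - u) have
   arrived since. *)

Require Import Defs.
From mathcomp Require Import all_boot all_order all_algebra.
From mathcomp Require Import zify.
From Stdlib Require Import Classical ClassicalEpsilon.

Set Implicit Arguments.
Unset Strict Implicit.
Unset Printing Implicit Defensive.

Local Notation arr T i := (arrival (nth_task T i)).

Lemma exists_minimum (P : nat -> Prop) : (exists m, P m) -> exists m, is_minimum P m.
Proof.
case=> m; elim/ltn_ind: m => m IH Pm.
have [[k ltkm Pk]|noP] := classic (exists2 k, k < m & P k); first exact: IH Pk.
exists m; split=> // k Pk; rewrite leqNgt; apply/negP => ltkm.
by apply: noP; exists k.
Qed.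

Lemma is_minimum_inj (P : nat -> Prop) m n :
  is_minimum P m -> is_minimum P n -> m = n.
Proof.
by case=> Pm minm [Pn minn]; apply/eqP; rewrite eqn_leq minm // minn.
Qed.

Lemma truncate_truncate T s t : s <= t -> truncate (truncate T t) s = truncate T s.
Proof.
move=> lest; rewrite /truncate -filter_predI; apply: eq_filter => x /=.
by case: leqP => //= xs; rewrite (leq_trans xs).
Qed.

Lemma truncate_nil T t : all (fun x => t < arrival x) T -> truncate T t = [::].
Proof. by elim: T => //= x T IH /andP[/ltn_geF-> /IH]. Qed.

Lemma arrival_head_le x T : sorted leq [seq arrival y | y <- x :: T] ->
  all (fun y => arrival x <= arrival y) T.
Proof. by move=> /(order_path_min leq_trans); rewrite all_map. Qed.

Lemma truncate_cat T t : sorted leq [seq arrival x | x <- T] ->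
  exists s, T = truncate T t ++ s.
Proof.
elim: T => [|x T IH] sT; first by exists [::].
have [s eqT] := IH (path_sorted sT); case: (leqP (arrival x) t) => xt.
  by exists s; rewrite /truncate /= xt /= {1}eqT.
exists (x :: T); rewrite truncate_nil //= xt.
apply: sub_all (arrival_head_le sT) => y /=; exact: leq_trans.
Qed.

Lemma size_truncate T t i : sorted leq [seq arrival x | x <- T] ->
  (i < size (truncate T t)) = (i < size T) && (arr T i <= t).
Proof.
elim: T i => // x T IH i sT.
have ge_x j : j < size T -> arrival x <= arr T j.
  exact/(all_nthP _ (arrival_head_le sT)).
case: (leqP (arrival x) t) => xt.
  rewrite /truncate /= xt; case: i => [|i] //=.
  by rewrite !ltnS IH // (path_sorted sT).
rewrite truncate_nil /= ?xt; last first.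
  by apply: sub_all (arrival_head_le sT) => y /=; exact: leq_trans.
case: i => [|i]; first by rewrite /nth_task /=; lia.
rewrite /nth_task /= ltnS -/(nth_task T i).
by have := ge_x i; lia.
Qed.

Lemma nth_truncate T t i : sorted leq [seq arrival x | x <- T] ->
  i < size (truncate T t) -> nth_task (truncate T t) i = nth_task T i.
Proof.
by move=> /truncate_cat - /(_ t)[s eqT] it; rewrite /nth_task {2}eqT nth_cat it.
Qed.

Lemma task_arrival_process_truncate T t :
  task_arrival_process T -> task_arrival_process (truncate T t).
Proof.
case=> sT wT; split.
  have [s eqT] := truncate_cat t sT.
  by move: sT; rewrite {1}eqT map_cat => /cat_sorted2[].
by rewrite /truncate all_filter; apply: sub_all wT => x /= ->; rewrite implybT.
Qed.

Lemma truncate_eq_le T T' s t :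
  s <= t -> truncate T t = truncate T' t -> truncate T s = truncate T' s.
Proof. by move=> st eqT; rewrite -(truncate_truncate T st) eqT truncate_truncate. Qed.

Lemma truncate_eq_task T T' t i :
  sorted leq [seq arrival x | x <- T] -> sorted leq [seq arrival x | x <- T'] ->
  truncate T t = truncate T' t -> i < size T -> arr T i <= t ->
  i < size T' /\ nth_task T' i = nth_task T i.
Proof.
move=> sT sT' eqT iT it.
have iX : i < size (truncate T t) by rewrite size_truncate ?iT.
have iX' : i < size (truncate T' t) by rewrite -eqT.
rewrite -(nth_truncate sT iX) eqT nth_truncate //.
by move: iX'; rewrite size_truncate // => /andP[].
Qed.

Section Counting.
Variable p : nat.
Implicit Types (S : schedule p).

Lemma processors_onE S s i :
  processors_on S s i = \sum_(q < p) (assigned S s q == Some i).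
Proof. by rewrite /processors_on cardsE -sum1_card big_mkcond. Qed.

Lemma sum_eq_Some n (P : pred nat) (o : option nat) :
  \sum_(i < n | P i) (o == Some (i : nat)) = (if o is Some j then (j < n) && P j else false).
Proof.
rewrite big_mkcond; case: o => [j|]; last by rewrite big1 // => i _; case: ifP.
elim: n => [|n IH]; first by rewrite big_ord0.
rewrite big_ord_recr /= IH; case: (ltngtP j n) => [jn|jn|->].
- by rewrite ltnS ltnW //= (_ : (_ == _) = false) ?if_same ?addn0 //; apply/eqP => -[]; lia.
- by rewrite ltnS leqNgt jn /= (_ : (_ == _) = false) ?if_same //; apply/eqP => -[]; lia.
- by rewrite ltnS leqnn /= eqxx; case: (P n).
Qed.

Lemma sum_processors_on S s n (P : pred nat) :
  \sum_(i < n | P i) processors_on S s i =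
  \sum_(q < p) (if assigned S s q is Some j then (j < n) && P j else false).
Proof.
under eq_bigr do rewrite processors_onE.
by rewrite exchange_big; apply: eq_bigr => q _; rewrite sum_eq_Some.
Qed.

Lemma sum_processors_on_le S s n (P : pred nat) :
  \sum_(i < n | P i) processors_on S s i <= p.
Proof.
rewrite sum_processors_on -[leqRHS]card_ord -sum1_card leq_sum // => q _.
by case: (assigned S s q) => // j; case: (_ && _).
Qed.

Lemma remaining_le T S s t i : s <= t -> remaining T S t i <= remaining T S s i.
Proof.
move=> st; apply: leq_sub2l; rewrite -!(big_mkord xpredT (fun u => processors_on S u i)).
by rewrite [leqRHS](big_cat_nat (leq0n s) st) //= leq_addr.
Qed.

Lemma remainingS T S s i :
  remaining T S s.+1 i = remaining T S s i - processors_on S s i.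
Proof. by rewrite /remaining big_ord_recr /= subnDA. Qed.

Definition restrict_schedule S n : schedule p :=
  Schedule (parallelized S)
    (fun s q => if assigned S s q is Some i then if i < n then Some i else None else None).

Lemma processors_on_restrict S n s i : i < n ->
  processors_on (restrict_schedule S n) s i = processors_on S s i.
Proof.
move=> ilt; rewrite !processors_onE; apply: eq_bigr => q _ /=.
case: (assigned S s q) => // j; case: ifP => // jn.
by congr (nat_of_bool _); apply/esym/eqP => -[]; lia.
Qed.

Lemma optimal_time_truncate_le T s t c d :
  sorted leq [seq arrival x | x <- T] -> s <= t ->
  optimal_time p (truncate T s) c -> optimal_time p (truncate T t) d -> c <= d.
Proof.
move=> sT st [_ minc] [[S [[vS1 vS2] cS]] _]; apply: minc.
set n := size (truncate T s).
have ltn i : i < n -> i < size (truncate T t).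
  by rewrite !size_truncate // => /andP[-> /leq_trans->].
have eqn i : i < n -> nth_task (truncate T s) i = nth_task (truncate T t) i.
  by move=> ilt; rewrite !nth_truncate // ltn.
exists (restrict_schedule S n); split; first split.
- move=> u q i /=; case eqq: assigned => [j|] //; case: ifP => // jn [<-].
  by have [_] := vS1 _ _ _ eqq; rewrite eqn.
- move=> u i /= Si; have [ilt|ige] := ltnP i n; first by rewrite processors_on_restrict ?vS2.
  rewrite processors_onE big1 // => q _ /=; case: assigned => // j; case: ifP => // jn.
  by rewrite (_ : (_ == _) = false) //; apply/eqP => -[]; lia.
move=> i ilt; have [ad rd] := cS i (ltn _ ilt); split; first by rewrite eqn.
move: rd; rewrite /remaining /total_work /= eqn //.
by under [X in _ -> _ - X = _]eq_bigr do rewrite processors_on_restrict //.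
Qed.

Lemma optimal_time_exists T : 0 < p -> exists c, optimal_time p T c.
Proof.
move=> p_gt0; apply: exists_minimum.
(* Task i is run alone on processor 0 during the steps of [i K, (i + 1) K). *)
pose K := (\sum_(x <- T) (arrival x + serial_work x)).+1.
have leK i : i < size T -> arr T i + serial_work (nth_task T i) < K.
  by move=> ilt; rewrite ltnS (big_nth no_task) big_mkord (bigD1 (Ordinal ilt)) //= leq_addr.
pose S : schedule p := Schedule (fun=> false) (fun s q =>
  if [&& q == Ordinal p_gt0, s %/ K < size T & arr T (s %/ K) <= s] then Some (s %/ K) else None).
have onS s i : processors_on S s i = [&& s %/ K == i, i < size T & arr T i <= s].
  rewrite processors_onE (bigD1 (Ordinal p_gt0)) //= big1 => [|q /negPf-> //].
  rewrite addn0; case: (s %/ K =P i) => [->|ne].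
    by case: (_ && _); rewrite ?eqxx.
  by case: ifP => // _; congr (nat_of_bool _); apply/eqP => -[].
exists (size T * K), S; split; first split.
- by move=> s q i /=; case: ifP => // /and3P[_ ? ?] [<-].
- by move=> s i _; rewrite onS leq_b1.
move=> i ilt; have ltK := leK i ilt; split; first by nia.
apply/eqP; rewrite subn_eq0 /total_work /=.
rewrite -(big_mkord xpredT (fun s => processors_on S s i)).
rewrite (@big_cat_nat _ _ _ (i * K + arr T i)) /=; [|lia|nia].
rewrite (@big_cat_nat _ _ _ (i.+1 * K) (i * K + arr T i)) /=; [|nia|nia].
apply: leq_trans (leq_trans (leq_addr _ _) (leq_addl _ _)).
rewrite (eq_big_nat _ _ (F2 := fun=> 1)); first by rewrite sum_nat_const_nat; nia.
move=> s /andP[s1 s2]; rewrite onS ilt (_ : arr T i <= s) ?andbT; last by lia.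
by rewrite (_ : s %/ K = i) ?eqxx //; apply/eqP; rewrite eqn_leq -ltnS ltn_divLR // s2 leq_divRL //; lia.
Qed.

End Counting.

Section OptimalWork.
Variables (p : nat) (T : instance) (t c : nat).
Hypotheses (T_process : task_arrival_process T) (c_opt : optimal_time p (truncate T t) c).

Lemma arrival_le_optimal_time i : i < size T -> arr T i <= t -> arr T i <= c.
Proof.
case: T_process => sT _ iT it; have iX : i < size (truncate T t) by rewrite size_truncate ?iT.
by case: c_opt => -[S [_ /(_ i iX)[]]] + _ _; rewrite nth_truncate.
Qed.

(* The work w i that an optimal schedule of the truncation at t spends on task
   i. *)
Lemma optimal_work : exists w : nat -> nat,
  (forall i, i < size T -> arr T i <= t ->
     serial_work (nth_task T i) <= w i /\
     (w i < parallel_work (nth_task T i) -> serial_work (nth_task T i) + arr T i <= c)) /\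
  (forall u, \sum_(i < size T | u <= arr T i <= t) w i <= p * (c - u)).
Proof.
case: T_process => sT /all_nthP - /(_ no_task) sp.
case: c_opt => -[S [[vS1 vS2] cS]] _; set X := truncate T t in vS1 vS2 cS.
have inX i : i < size T -> arr T i <= t -> i < size X by rewrite size_truncate // => ->.
have before s i : s < arr T i -> processors_on S s i = 0.
  move=> sa; rewrite processors_onE big1 // => q _; case: eqP => // /vS1[iX].
  by rewrite nth_truncate // leqNgt sa.
have work_le i : i < size T -> arr T i <= t -> total_work X S i <= \sum_(s < c) processors_on S s i.
  by move=> iT it; have [_ /eqP] := cS i (inX _ iT it); rewrite subn_eq0.
exists (total_work X S); split=> [i iT it|u].
  have := work_le i iT it; have := sp i iT; rewrite /total_work nth_truncate ?inX // -/(nth_task T i).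
  case Si: (parallelized S i); first by split; lia.
  move=> _ work; split=> // _; have ac := arrival_le_optimal_time iT it.
  suff : \sum_(s < c) processors_on S s i <= c - arr T i by lia.
  rewrite -(big_mkord xpredT (fun s => processors_on S s i)) (@big_cat_nat _ _ _ (arr T i)) //=.
  rewrite big_nat big1 ?add0n => [|s /andP[_ /before] //].
  rewrite -[leqRHS]muln1 -sum_nat_const_nat; apply: leq_sum => s _.
  by apply: vS2; rewrite Si.
apply: (@leq_trans (\sum_(i < size T | u <= arr T i <= t) \sum_(u <= s < c) processors_on S s i)).
  apply: leq_sum => i /andP[ui it]; apply: leq_trans (work_le i (ltn_ord i) it) _.
  rewrite -(big_mkord xpredT (fun s => processors_on S s i)).
  have uc : u <= c := leq_trans ui (arrival_le_optimal_time (ltn_ord i) it).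
  rewrite (@big_cat_nat _ _ _ u) //= big_nat big1 // => s /andP[_ su].
  by apply: before; lia.
rewrite exchange_big /= mulnC -sum_nat_const_nat; apply: leq_sum => s _.
exact: (sum_processors_on_le S s _ (fun i => u <= arr T i <= t)).
Qed.

End OptimalWork.

Section InsSchedule.
Variables (p : nat) (T : instance) (S : schedule p) (C : nat -> nat).
Hypotheses (T_process : task_arrival_process T) (S_decision : ins_decision T S)
  (S_step : forall s, ins_step T S s)
  (C_opt : forall t, optimal_time p (truncate T t) (C t)).

Local Notation R := (remaining T S).
Local Notation load s t := (\sum_(i < size T | arr T i <= t) R s i).

Let C_mono s t : s <= t -> C s <= C t.
Proof. by move=> st; apply: (optimal_time_truncate_le (proj1 T_process) st). Qed.

Lemma ins_parallelized i : i < size T ->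
  parallelized S i = (2 * C (arr T i) < serial_work (nth_task T i) + arr T i).
Proof.
by move=> /S_decision[c [/is_minimum_inj/(_ (C_opt _))->]].
Qed.

Lemma ins_processors_on_le s i : processors_on S s i <= R s i.
Proof.
case: (S_step s) => S1 /(_ i) S2 _ _ _; move: S2; case: ifP => // _ S2.
rewrite processors_onE; have [q /eqP/S1/and3P[_ _]|no] := pickP (fun q => assigned S s q == Some i).
  by rewrite -processors_onE; apply: leq_trans.
by rewrite big1 // => q _; rewrite no.
Qed.

Lemma ins_not_arrived s i : s < arr T i -> processors_on S s i = 0.
Proof.
case: (S_step s) => S1 _ _ _ _ si; rewrite processors_onE big1 // => q _.
by case: eqP => // /S1/and3P[_]; rewrite leqNgt si.
Qed.

Lemma remaining_at_arrival s i : s <= arr T i -> R s i = total_work T S i.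
Proof.
elim: s => [|s IH] si; first by rewrite /remaining big_ord0 subn0.
by rewrite remainingS ins_not_arrived // IH ?subn0 // ltnW.
Qed.

Definition saturated s := [forall q, assigned S s q != None].

Lemma saturated_load s t : s <= t -> saturated s -> load s.+1 t + p = load s t.
Proof.
move=> st /forallP sat; have [S1 _ _ _ _] := S_step s.
suff sum_p : \sum_(i < size T | arr T i <= t) processors_on S s i = p.
  rewrite -[X in _ + X = _]sum_p -big_split /=; apply: eq_bigr => i _; rewrite remainingS subnK //.
  exact: ins_processors_on_le.
rewrite (sum_processors_on S s _ (fun i => arr T i <= t)) -[RHS]card_ord -sum1_card.
apply: eq_bigr => q _; have := sat q; case eqq: assigned => [j|] // _.
by have /and3P[-> /leq_trans-> //] := S1 _ _ eqq.
Qed.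

Lemma card_running s (q : 'I_p) : assigned S s q = None ->
  #|running_serial_jobs T S s| < p.
Proof.
move=> idle; apply: (@leq_ltn_trans (\sum_(i < size T) processors_on S s i)).
  rewrite -sum1_card [leqRHS](bigID (mem (running_serial_jobs T S s))) /=.
  by apply: leq_trans (leq_addr _ _); apply: leq_sum => i; rewrite inE => /andP[].
rewrite (sum_processors_on S s _ xpredT) (bigD1 q) //= idle add0n.
apply: (@leq_ltn_trans (\sum_(r < p | r != q) 1)).
  by apply: leq_sum => r _; case: assigned => // j; rewrite andbT; case: (_ < _).
by rewrite sum1_card cardC1 card_ord; case: (p) q {idle} => [[]|].
Qed.

Lemma unsaturated_parallel s i : ~~ saturated s -> i < size T -> arr T i <= s ->
  parallelized S i -> R s.+1 i = 0.
Proof.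
case/forallPn => q /negPn/eqP idle iT si par; have [_ _ _ S4 _] := S_step s.
rewrite remainingS; case: (posnP (R s i)) => [-> //|R0].
by rewrite (S4 q idle) ?subnn // /present iT si.
Qed.

Lemma unsaturated_serial s : ~~ saturated s -> #|serial_jobs T S s| < p.
Proof.
case/forallPn => q /negPn/eqP /card_running; have [_ _ [-> _] _ _] := S_step s.
by rewrite gtn_min ltnn.
Qed.

Lemma load_serial s D i : load s s <= p * D ->
  (forall j, j < size T -> arr T j <= s -> ~~ parallelized S j -> R s j <= D) ->
  i < size T -> arr T i <= s -> ~~ parallelized S i -> R s.+1 i <= D.-1.
Proof.
move=> loadD serD iT si Si; have [_ _ [card_run lrpt] _ _] := S_step s.
have := serD i iT si Si; rewrite leq_eqVlt => /orP[/eqP RD|]; last first.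
  by have := remaining_le T S i (leqnSn s); lia.
have [D0|D0] := posnP D.
  by have := remaining_le T S i (leqnSn s); lia.
have iser : Ordinal iT \in serial_jobs T S s by rewrite inE /present iT si RD D0.
have [irun|inotrun] := boolP (Ordinal iT \in running_serial_jobs T S s).
  by move: irun; rewrite inE => /andP[_] /=; rewrite remainingS; lia.
(* Otherwise i and the p jobs that run in its place have D work left each. *)
have card_p : #|running_serial_jobs T S s| = p.
  suff : #|running_serial_jobs T S s| < #|serial_jobs T S s| by rewrite card_run; lia.
  apply/proper_card/properP; split; last by exists (Ordinal iT).
  by apply/subsetP => j; rewrite inE => /andP[].
have : #|Ordinal iT |: running_serial_jobs T S s| * D <= load s s.
  rewrite -sum_nat_const [leqRHS](bigID (mem (Ordinal iT |: running_serial_jobs T S s))) /=.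
  apply: leq_trans (leq_addr _ _); rewrite [leqRHS](eq_bigl (mem (Ordinal iT |: running_serial_jobs T S s))).
    apply: leq_sum => j /setU1P[->|jrun]; rewrite -RD //.
    exact: lrpt jrun iser inotrun.
  move=> j /=; rewrite andb_idl // => /setU1P[->//|].
  by rewrite !inE => /andP[/andP[/and3P[]]].
by rewrite cardsU1 inotrun card_p; nia.
Qed.

Lemma load_step s D : load s s <= p * D ->
  (forall j, j < size T -> arr T j <= s -> ~~ parallelized S j -> R s j <= D) ->
  load s.+1 s <= p * D.-1.
Proof.
move=> loadD serD; have [sat|unsat] := boolP (saturated s).
  by have := saturated_load (leqnn s) sat; nia.
apply: (@leq_trans (#|serial_jobs T S s| * D.-1)); last first.
  by rewrite leq_mul2r ltnW ?orbT // unsaturated_serial.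
rewrite -sum_nat_const big_mkcond [leqRHS]big_mkcond; apply: leq_sum => i _.
case: ifP => // si; case: ifP => [|/negbT].
  by move=> iser; apply: load_serial => //; move: iser; rewrite inE => /andP[].
rewrite inE negb_and negbK /present ltn_ord si /= -leqNgt leqn0 => /orP[/eqP R0|par].
  by rewrite remainingS R0.
by rewrite unsaturated_parallel.
Qed.

Definition ins_invariant s :=
  load s s <= p * (2 * C s - s) /\
  forall i, i < size T -> arr T i <= s -> ~~ parallelized S i -> R s i <= 2 * C s - s.

Lemma load_at_arrival t : (forall s, s < t -> ins_invariant s) ->
  (exists2 i, i < size T & arr T i = t) -> load t t <= p * (2 * C t - t).
Proof.
move=> inv [i0 iT0 arr0].
have tC : t <= C t by rewrite -{1}arr0 (arrival_le_optimal_time T_process (C_opt t)) ?arr0.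
have [w [w_ge w_sum]] := optimal_work T_process (C_opt t).
have sumw : \sum_(i < size T | arr T i <= t) w i <= p * C t by have := w_sum 0; rewrite subn0.
have final : (forall i, i < size T -> arr T i <= t -> R t i <= w i) ->
    load t t <= p * (2 * C t - t).
  move=> Rw; apply: leq_trans (_ : p * C t <= _); last by rewrite leq_mul2l; lia.
  by apply: leq_trans sumw; apply: leq_sum => i; apply: Rw.
have R_le s i : R s i <= total_work T S i by apply: leq_subr.
pose dis (i : 'I_(size T)) :=
  [&& arr T i <= t, parallelized S i & w i < parallel_work (nth_task T i)].
have agree (i : 'I_(size T)) : arr T i <= t -> ~~ dis i -> total_work T S i <= w i.
  move=> it; rewrite /dis it /total_work /=; case: ifP => /= _; first by rewrite -leqNgt.
  by have [] := w_ge i (ltn_ord i) it.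
have [d0 dis0|nodis] := pickP dis; last first.
  apply: final => i iT it; apply: leq_trans (R_le _ _) _.
  by apply: (agree (Ordinal iT)); rewrite ?nodis.
have [d /and3P[dt dpar dw] dmax] := arg_maxnP (fun i : 'I_(size T) => arr T i) dis0.
set u := arr T d in dt dmax.
have uC : 2 * C u < C t.
  have [_ /(_ dw)] := w_ge d (ltn_ord d) dt.
  by move: dpar; rewrite ins_parallelized //; apply: leq_trans.
have ut : u < t.
  by rewrite ltn_neqAle dt andbT; apply/eqP => eqt; move: uC; rewrite eqt; lia.
have uCu : u <= C u by apply: (arrival_le_optimal_time T_process (C_opt u)).
have later (i : 'I_(size T)) : u < arr T i <= t -> total_work T S i <= w i.
  case/andP=> ui it; apply: agree => //; apply/negP => /dmax; rewrite /= -/u; lia.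
have [/existsP[v]|] := boolP ([exists v : 'I_t, (u <= v) && ~~ saturated v]).
  (* Only tasks that ins serializes survive an unsaturated step. *)
  case/andP=> uv unsat; apply: final => i iT it.
  have [iu|ui] := leqP (arr T i) u; last first.
    by apply: leq_trans (R_le _ _) (later (Ordinal iT) _); rewrite ui.
  case par: (parallelized S i).
    have := remaining_le T S i (ltn_ord v).
    by rewrite (unsaturated_parallel unsat) ?(leq_trans iu) // leqn0 => /eqP->.
  by apply: leq_trans (R_le _ _) _; rewrite /total_work par; case: (w_ge i iT it).
rewrite negb_exists => /forallP allsat.
have sat s : u <= s -> s < t -> saturated s.
  by move=> us st; have := allsat (Ordinal st); rewrite us negbK.
have drop k : u + k <= t -> load (u + k) t + k * p = load u t.
  elim: k => [|k IH] kt; first by rewrite addn0 mul0n addn0.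
  by rewrite -IH ?addnS; [rewrite -(saturated_load (s := u + k)) ?sat //; lia|lia].
have := drop (t - u); rewrite (subnKC dt) => /(_ (leqnn t)) loadt.
have loadu : load u t <= p * (2 * C u - u) + p * (C t - u).
  rewrite (bigID (fun i : 'I_(size T) => arr T i <= u)) /= leq_add //.
    rewrite (eq_bigl (fun i : 'I_(size T) => arr T i <= u)); first by case: (inv u ut).
    by move=> i /=; case: (leqP (arr T i) u) => iu; rewrite ?andbF // (leq_trans iu).
  apply: leq_trans (w_sum u); rewrite big_mkcond [leqRHS]big_mkcond.
  apply: leq_sum => i _; rewrite -ltnNge; case: ifP => // /andP[it ui].
  by rewrite (ltnW ui) it /=; apply: leq_trans (R_le _ _) (later i _); rewrite ui.
rewrite -(leq_add2r ((t - u) * p)) loadt (leq_trans loadu) //.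
by rewrite [(t - u) * p]mulnC -!mulnDr leq_mul2l; lia.
Qed.

Lemma ins_invariantP s : ins_invariant s.
Proof.
elim/ltn_ind: s => s inv.
have arrived i : i < size T -> arr T i = s -> ~~ parallelized S i -> R s i <= 2 * C s - s.
  move=> iT <-; rewrite remaining_at_arrival // /total_work ins_parallelized // => nlt.
  by rewrite (negPf nlt); lia.
have none_or : (exists2 i, i < size T & arr T i = s) \/ (forall i, i < size T -> arr T i != s).
  have [/existsP[i /eqP]|] := boolP ([exists i : 'I_(size T), arr T i == s]); first by left; exists i.
  by rewrite negb_exists => /forallP no; right => i iT; apply: (no (Ordinal iT)).
case: s => [|s] in inv arrived none_or *.
  split=> [|i iT]; last by rewrite leqn0 => /eqP; apply: arrived.
  case: none_or => [|no]; first exact: load_at_arrival.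
  by rewrite big1 // => i; rewrite leqn0 (negPf (no i (ltn_ord i))).
have [loads sers] := inv s (leqnn _).
have Cs : (2 * C s - s).-1 <= 2 * C s.+1 - s.+1 by have := C_mono (leqnSn s); lia.
split.
  case: none_or => [|no]; first exact: load_at_arrival.
  rewrite (eq_bigl (fun i : 'I_(size T) => arr T i <= s)).
    by apply: leq_trans (load_step loads sers) _; rewrite leq_mul2l Cs orbT.
  by move=> i; rewrite leq_eqVlt (negPf (no i (ltn_ord i))).
move=> i iT; rewrite leq_eqVlt => /orP[/eqP|si Si]; first exact: arrived.
by apply: leq_trans Cs; apply: load_serial.
Qed.

Lemma ins_completed t : truncate T t = T -> completed_by T S (2 * C t).
Proof.
move=> Tt i iT.
have le_t j : j < size T -> arr T j <= t.
  by move=> jT; have := size_truncate t j (proj1 T_process); rewrite Tt jT => /esym.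
have aC j : j < size T -> arr T j <= C t.
  by move=> jT; apply: (arrival_le_optimal_time T_process (C_opt t)) => //; apply: le_t.
split; first by have := aC i iT; lia.
have [load0 _] := ins_invariantP (2 * C t).
have CC : C (2 * C t) <= C t.
  rewrite (is_minimum_inj (C_opt (2 * C t)) (_ : optimal_time p _ (C t))) //.
  suff -> : truncate T (2 * C t) = truncate T t by [].
  rewrite Tt /truncate; apply/all_filterP/(all_nthP no_task) => j jT.
  by have := aC j jT; rewrite /nth_task; lia.
move: load0; rewrite (_ : _ - _ = 0) ?muln0 ?leqn0 ?sum_nat_eq0; last by lia.
move=> /forall_inP/(_ (Ordinal iT))/= /implyP; rewrite (_ : _ <= _) => [/eqP//|].
by have := aC i iT; lia.
Qed.

End InsSchedule.

Lemma card_ord_seq n (s : seq nat) : uniq s -> all (fun i => i < n) s ->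
  #|[set i : 'I_n | (i : nat) \in s]| = size s.
Proof.
move=> us /allP sn; rewrite cardE -(size_map val); apply/perm_size/uniq_perm => //.
  by rewrite (map_inj_uniq val_inj) enum_uniq.
move=> i; apply/mapP/idP => [[j]|si]; first by rewrite mem_enum inE => ? ->.
by exists (Ordinal (sn i si)); rewrite // mem_enum inE.
Qed.

Lemma onth_mem (T : eqType) (s : seq T) k x : onth s k = Some x -> x \in s.
Proof. by move=> sk; apply/onthP; exists k. Qed.

Lemma sum_onth p (s : seq nat) i :
  \sum_(q < p) (onth s q == Some i) = count_mem i (take p s).
Proof.
elim: p s => [|p IH] s; first by rewrite big_ord0 take0.
  case: s => [|x s] /=.
  by rewrite big1 // => q _; rewrite onth0n.
by rewrite big_ord_recl /= IH.
Qed.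

Section Queue.
Variables (n : nat) (par : pred nat) (r : nat -> nat) (p : nat).

Definition serial_queue : seq nat :=
  sort (fun i j => r j <= r i) [seq i <- iota 0 n | ~~ par i && (0 < r i)].
Definition parallel_queue : seq nat :=
  flatten [seq nseq (r i) i | i <- [seq i <- iota 0 n | par i]].
Definition queue := serial_queue ++ parallel_queue.

Local Notation c i := (count_mem i (take p queue)).

Lemma mem_serial_queue i :
  (i \in serial_queue) = [&& i < n, ~~ par i & 0 < r i].
Proof. by rewrite mem_sort mem_filter mem_iota /= add0n andbC. Qed.

Lemma uniq_serial_queue : uniq serial_queue.
Proof. by rewrite sort_uniq filter_uniq // iota_uniq. Qed.

Lemma count_flatten_nseq s i : uniq s ->
  count_mem i (flatten [seq nseq (r j) j | j <- s]) = if i \in s then r i else 0.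
Proof.
elim: s => //= x s IH /andP[xs /IH]; rewrite count_cat count_nseq in_cons => -> /=.
by have [<-|] := eqVneq x i; rewrite ?(negPf xs) ?mul1n ?addn0.
Qed.

Lemma count_parallel_queue i :
  count_mem i parallel_queue = if (i < n) && par i then r i else 0.
Proof.
rewrite count_flatten_nseq; last by rewrite filter_uniq // iota_uniq.
by rewrite mem_filter mem_iota andbC.
Qed.

Lemma mem_parallel_queue i :
  (i \in parallel_queue) = [&& i < n, par i & 0 < r i].
Proof.
by rewrite -has_pred1 has_count count_parallel_queue andbA; case: ifP.
Qed.

Lemma take_queue : take p queue =
  take p serial_queue ++ take (p - size serial_queue) parallel_queue.
Proof.
rewrite /queue take_cat; case: ltnP => [lt|le].
  by rewrite (eqP (_ : p - _ == 0)) ?subn_eq0 ?(ltnW lt) // take0 cats0.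
by rewrite (take_oversize le).
Qed.

Lemma mem_queue i : i \in queue -> (i < n) && (0 < r i).
Proof.
by rewrite mem_cat mem_serial_queue mem_parallel_queue => /orP[] /and3P[-> _ ->].
Qed.

Lemma count_take_le (T : Type) (a : pred T) m s : count a (take m s) <= count a s.
Proof. by rewrite -{2}(cat_take_drop m s) count_cat leq_addr. Qed.

Lemma count_parallel i : par i -> c i = count_mem i (take (p - size serial_queue) parallel_queue).
Proof.
move=> pi; rewrite take_queue count_cat (count_memPn _) //.
by apply/negP => /mem_take; rewrite mem_serial_queue pi andbF.
Qed.

Lemma count_serial i : ~~ par i -> c i = (i \in take p serial_queue).
Proof.
move=> pi; rewrite take_queue count_cat [X in _ + X](count_memPn _) ?addn0.
  by rewrite count_uniq_mem // take_uniq // uniq_serial_queue.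
by apply/negP => /mem_take; rewrite mem_parallel_queue (negPf pi) andbF.
Qed.

Lemma count_queue_le i : c i <= if par i then r i else 1.
Proof.
case: ifP => [pi|/negbT pi]; last by rewrite count_serial // leq_b1.
rewrite count_parallel // (leq_trans (count_take_le _ _ _)) // count_parallel_queue.
by case: ifP.
Qed.

Lemma serial_queue_order i j : i \in take p serial_queue -> j \in serial_queue ->
  j \notin take p serial_queue -> r j <= r i.
Proof.
have : pairwise (fun i j => r j <= r i) serial_queue.
  rewrite -sorted_pairwise; first by apply: sort_sorted => x y; apply: leq_total.
  by move=> x y z yx xz; apply: leq_trans xz yx.
rewrite -{1 3}(cat_take_drop p serial_queue) pairwise_cat => /andP[/allrelP ord _].
by move=> ip; rewrite mem_cat => /orP[->//|jd _]; apply: ord.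
Qed.

Lemma count_queue_idle i : size queue < p -> i < n -> par i -> c i = r i.
Proof.
move=> lt iltn pi; rewrite count_parallel // take_oversize.
  by rewrite count_parallel_queue iltn pi.
by move: lt; rewrite size_cat; lia.
Qed.

Lemma count_take_flatten_nseq s m i j : uniq s -> i != j ->
  let t := take m (flatten [seq nseq (r k) k | k <- s]) in
  0 < count_mem i t -> 0 < count_mem j t ->
  count_mem i t = r i \/ count_mem j t = r j.
Proof.
elim: s m => //= x s IH m /andP[xs us] ij; rewrite take_cat size_nseq.
case: (ltnP m (r x)) => [lt|le].
  rewrite take_nseq ?(ltnW lt) // !count_nseq /=.
  have [xi _|_] := eqVneq x i; last by rewrite mul0n ltnn.
  by rewrite xi (negPf ij) mul0n ltnn.
rewrite !count_cat !count_nseq /=; have [xi|xi] := eqVneq x i.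
  rewrite -xi (count_memPn _) ?mul1n ?addn0; first by left.
  apply: contra xs => /mem_take; rewrite -has_pred1 has_count count_flatten_nseq //.
  by case: ifP.
have [xj|xj] := eqVneq x j.
  rewrite -xj [X in _ + X = r x](count_memPn _) ?mul1n ?addn0; first by right.
  apply: contra xs => /mem_take; rewrite -has_pred1 has_count count_flatten_nseq //.
  by case: ifP.
by rewrite !mul0n !add0n; apply: IH.
Qed.

Lemma count_queue_partial i j : i != j -> par i -> par j -> 0 < c i -> 0 < c j ->
  c i = r i \/ c j = r j.
Proof.
move=> ij pi pj; rewrite !count_parallel //; apply: count_take_flatten_nseq => //.
by rewrite filter_uniq // iota_uniq.
Qed.

End Queue.

Section Existence.
Variables (p : nat) (opt : instance -> nat).
Hypothesis optP : forall T, optimal_time p T (opt T).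

Definition ins_par (T : instance) (i : nat) : bool :=
  2 * opt (truncate T (arr T i)) < serial_work (nth_task T i) + arr T i.

Definition ins_total (T : instance) (i : nat) : nat :=
  if ins_par T i then parallel_work (nth_task T i) else serial_work (nth_task T i).

Definition ins_queue (T : instance) (done : nat -> nat) : seq nat :=
  queue (size T) (ins_par T) (fun i => ins_total T i - done i).

Fixpoint ins_done (T : instance) (s : nat) : nat -> nat :=
  if s is u.+1 then
    fun i => ins_done T u i + count_mem i (take p (ins_queue (truncate T u) (ins_done T u)))
  else fun=> 0.

Definition ins (T : instance) : schedule p :=
  Schedule (ins_par T) (fun s q => onth (ins_queue (truncate T s) (ins_done T s)) q).

Lemma processors_on_ins T s i :
  processors_on (ins T) s i = count_mem i (take p (ins_queue (truncate T s) (ins_done T s))).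
Proof. by rewrite processors_onE sum_onth. Qed.

Lemma remaining_ins T s i : remaining T (ins T) s i = ins_total T i - ins_done T s i.
Proof.
congr (_ - _); elim: s => [|s IH]; first by rewrite big_ord0.
by rewrite big_ord_recr /= IH processors_on_ins.
Qed.

Lemma ins_done_truncate T T' s :
  truncate T s = truncate T' s -> ins_done T s = ins_done T' s.
Proof.
elim: s => //= s IH eqT; have eqT' := truncate_eq_le (leqnSn s) eqT.
by rewrite IH // eqT'.
Qed.

Lemma ins_par_truncate T T' t i :
  sorted leq [seq arrival x | x <- T] -> sorted leq [seq arrival x | x <- T'] ->
  truncate T t = truncate T' t -> i < size T -> arr T i <= t ->
  ins_par T i = ins_par T' i.
Proof.
move=> sT sT' eqT iT it; have [_ eqi] := truncate_eq_task sT sT' eqT iT it.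
by rewrite /ins_par eqi (truncate_eq_le it eqT).
Qed.

Lemma ins_is_ins : is_ins ins.
Proof.
split=> [T T' s [sT _] [sT' _] eqT q|T TP].
  rewrite /= eqT (ins_done_truncate eqT); split=> // i.
  move=> /onth_mem /mem_queue /andP[]; rewrite -eqT size_truncate // => /andP[iT it] _.
  exact: ins_par_truncate eqT iT it.
have sT := proj1 TP; split=> [i iT|s].
  by exists (opt (truncate T (arr T i))).
set X := truncate T s; pose n := size X.
have sX : sorted leq [seq arrival x | x <- X] := proj1 (task_arrival_process_truncate s TP).
have nE i : (i < n) = (i < size T) && (arr T i <= s) by apply: size_truncate.
have parE i : i < n -> ins_par X i = ins_par T i.
  rewrite nE => /andP[iT it]; symmetry; apply: ins_par_truncate iT it => //.
  by rewrite truncate_truncate.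
pose r i := ins_total X i - ins_done T s i.
have rE i : i < n -> r i = remaining T (ins T) s i.
  by move=> ilt; rewrite remaining_ins /r /ins_total parE // nth_truncate.
pose Q := queue n (ins_par X) r.
have onE i : processors_on (ins T) s i = count_mem i (take p Q).
  exact: processors_on_ins.
have onn i : 0 < processors_on (ins T) s i -> i < n.
  by rewrite onE -has_count has_pred1 => /mem_take/mem_queue/andP[].
have serE (i : 'I_(size T)) :
    (i \in serial_jobs T (ins T) s) = ((i : nat) \in serial_queue n (ins_par X) r).
  rewrite inE mem_serial_queue /present andbA -nE.
  by case: ltnP => //= ilt; rewrite rE // parE // andbC.
have runE (i : 'I_(size T)) : (i \in running_serial_jobs T (ins T) s) =
    ((i : nat) \in take p (serial_queue n (ins_par X) r)).
  rewrite inE serE onE; apply/andP/idP => [[iser]|irun].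
    move: iser; rewrite mem_serial_queue => /and3P[_ npar _].
    by rewrite count_serial // lt0b.
  have iser := mem_take irun; split=> //.
  move: iser; rewrite mem_serial_queue => /and3P[_ npar _].
  by rewrite count_serial // irun.
have serlt : all (fun i => i < size T) (serial_queue n (ins_par X) r).
  by apply/allP => i; rewrite mem_serial_queue nE -andbA => /andP[].
split.
- move=> q i /onth_mem/mem_queue/andP[ilt]; rewrite -/(r i) rE // /present andbA -nE.
  by rewrite ilt.
- move=> i; have [->|/onn ilt] := posnP (processors_on (ins T) s i); first by [].
  by rewrite onE -rE //= -parE //; apply: count_queue_le.
- split=> [|i j]; last first.
    rewrite !runE serE => irun jser jnot.
    have jlt : j < n by move: jser; rewrite mem_serial_queue => /andP[].
    have ilt : i < n by move: (mem_take irun); rewrite mem_serial_queue => /andP[].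
    by rewrite -!rE //; apply: serial_queue_order jnot.
  set Q1 := serial_queue _ _ _ in serE runE serlt.
  have -> : running_serial_jobs T (ins T) s = [set i : 'I_(size T) | (i : nat) \in take p Q1].
    by apply/setP => i; rewrite [RHS]inE runE.
  have -> : serial_jobs T (ins T) s = [set i : 'I_(size T) | (i : nat) \in Q1].
    by apply/setP => i; rewrite [RHS]inE serE.
  have uQ1 : uniq Q1 by apply: uniq_serial_queue.
  rewrite !card_ord_seq ?take_uniq ?size_take_min //.
  by apply/allP => i /mem_take; apply: (allP serlt).
- move=> q /= idle i /and3P[iT it _] par; have ilt : i < n by rewrite nE iT.
  rewrite onE -rE //; apply: count_queue_idle; rewrite ?parE //.
  by apply: leq_ltn_trans (ltn_ord q); rewrite leqNgt -onthTE idle.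
- move=> i j ij pari parj /[dup] /onn ilt ci /[dup] /onn jlt cj.
  rewrite -!rE // !onE; apply: count_queue_partial; rewrite ?parE -?onE //.
Qed.

End Existence.

Lemma truncate_id T : exists t, truncate T t = T.
Proof.
exists (\sum_(i < size T) arr T i); apply/all_filterP/(all_nthP no_task) => i iT.
by rewrite (bigD1 (Ordinal iT)) //= leq_addr.
Qed.

Theorem theorem6p3 (p : nat) (p_gt0 : 0 < p) :
  (exists A : scheduler p, is_ins A) /\
  (forall A : scheduler p, is_ins A ->
     instantly_committing_scheduler A /\ competitive (2%:R%R : rat) A).
Proof.
pose opt T := proj1_sig (constructive_indefinite_description _ (optimal_time_exists T p_gt0)).
have optP T : optimal_time p T (opt T) by rewrite /opt; case: constructive_indefinite_description.
split; first by exists (ins p opt); apply: ins_is_ins.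
move=> A [A_online A_ins].
have completed T : task_arrival_process T -> completed_by T (A T) (2 * opt T).
  move=> TP; have [A_dec A_step] := A_ins T TP; have [t Tt] := truncate_id T.
  rewrite -{3}Tt; apply: (ins_completed (C := fun t => opt (truncate T t))) => //.
split; first split=> //.
- move=> T TP; have [_ A_step] := A_ins T TP; split; last by exists (2 * opt T); apply: completed.
  split=> [s q i sq|s i npar]; have [S1 S2 _ _ _] := A_step s.
    by have /and3P[] := S1 q i sq.
  by have := S2 i; rewrite (negPf npar).
- move=> T T' i TP TP' iT t eqT.
  have [iT' eqi] := truncate_eq_task (proj1 TP) (proj1 TP') eqT iT (leqnn t).
  have [/(_ i iT)[c [c_opt ->]] _] := A_ins T TP.
  have [/(_ i iT')[c' [c'_opt ->]] _] := A_ins T' TP'.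
  rewrite eqi -/t in c'_opt *; rewrite -eqT in c'_opt.
  by rewrite (is_minimum_inj c_opt c'_opt).
move=> T TP; have [m m_min] := exists_minimum (ex_intro _ _ (completed T TP)).
exists m, (opt T); split=> //; rewrite -GRing.natrM Num.Theory.ler_nat.
by apply: (proj2 m_min); apply: completed.
Qed.
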